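(* Let $G$ and $H$ be groups, let $A$ be a finite set with $|A|\ge 2$, and let $\phi : H\to G$ be a group homomorphism. Every $\phi$-cellular automaton $\tau : A^G\to A^H$ is $\phi$-equivariant.
   Context: For a group $G$, $A^G$ is the set of all functions $x : G \to A$, with the shift action $(g\cdot x)(h) := x(g^{-1}h)$ for $x \in A^G$, $g,h\in G$; likewise for $A^H$. A function $\tau : A^G \to A^H$ is a $\phi$-cellular automaton if there are a finite subset $S \subseteq G$ and a function $\mu : A^S \to A$ such that $\tau(x)(h) = \mu((\phi(h^{-1})\cdot x)|_S)$ for all $x \in A^G$, $h \in H$. A function $\tau : A^G \to A^H$ is $\phi$-equivariant if $h \cdot \tau(x) = \tau(\phi(h)\cdot x)$ for all $x \in A^G$, $h \in H$. *)

(* Defs.v *)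
From mathcomp Require Import all_boot finmap.

Set Implicit Arguments.
Unset Strict Implicit.
Unset Printing Implicit Defensive.

Local Open Scope group_scope.

Definition shift (G : groupType) (A : Type) (g : G) (x : G -> A) : G -> A :=
  fun h => x (g^-1 * h).

Definition restrict (G : groupType) (A : Type) (S : {fset G}) (x : G -> A) :
    S -> A :=
  fun s => x (val s).

Arguments restrict {G A} S x.

(* A group homomorphism is a {multiplicative H -> G}; preservation of 1 and of
   inverses follows. *)
Definition is_cellular_automaton (G H : groupType) (A : Type)
    (phi : {multiplicative H -> G}) (tau : (G -> A) -> (H -> A)) : Prop :=
  exists (S : {fset G}) (mu : (S -> A) -> A),
    forall (x : G -> A) (h : H),
      tau x h = mu (restrict S (shift (phi h^-1) x)).

Definition is_equivariant (G H : groupType) (A : Type)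
    (phi : {multiplicative H -> G}) (tau : (G -> A) -> (H -> A)) : Prop :=
  forall (x : G -> A) (h : H), shift h (tau x) = tau (shift (phi h) x).

(* Main.v *)
Require Import Defs.
From mathcomp Require Import all_boot finmap.
From Stdlib Require Import FunctionalExtensionality.

(** The local rule of a cellular automaton reads [x] at [h] only through the
    shifted configuration [phi h^-1 . x].  At [h^-1 * k] this configuration is
    [phi (k^-1 * h) . x], which, [phi] being a homomorphism and the shift a
    left action ([shiftM]), is also [phi k^-1 . (phi h . x)], the one read at
    [k] when the automaton is applied to [phi h . x].  Equal inputs give equal
    outputs. *)

Local Open Scope group_scope.

Lemma shiftM (G : groupType) (A : Type) (g k : G) (x : G -> A) :
  shift (g * k) x = shift g (shift k x).
Proof.
by apply: functional_extensionality => h; rewrite /shift invgM mulgA.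
Qed.

Local Close Scope group_scope.

Theorem lemma1 (G H : groupType) (A : finType) (hA : (2 <= #|A|)%N)
    (phi : {multiplicative H -> G}) (tau : (G -> A) -> (H -> A)) :
  is_cellular_automaton phi tau -> is_equivariant phi tau.
Proof.
move=> [S [mu tauE]] x h; apply: functional_extensionality => k.
by rewrite {1}/shift !tauE invgM invgK gmulfM shiftM.
Qed.
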